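(* Let $G$ be a finite group. If the rational group algebra $\mathbb{Q}G$ has a simple component (in its Wedderburn decomposition) which is isomorphic to a $2\times 2$-matrix ring over a quadratic imaginary extension of $\mathbb{Q}$, then this component is isomorphic to a $2\times 2$-matrix ring $M_2(K)$ over one of the following fields $K$: (1) $\mathbb{Q}(\sqrt{-1})$, (2) $\mathbb{Q}(\sqrt{-2})$, (3) $\mathbb{Q}(\sqrt{-3})$. Moreover, if $K\in\{\mathbb{Q}(\sqrt{-1}),\mathbb{Q}(\sqrt{-2}),\mathbb{Q}(\sqrt{-3})\}$ and $H$ is a finite subgroup of the unit group $\mathcal{U}(M_2(K))$, then $H$ is solvable and $|H|=2^a3^b$ for some $a,b\in\mathbb{N}$.
   Context: For a finite group $G$, let $e_1,\dots,e_n$ be the primitive central idempotents of $\mathbb{Q}G$. The Wedderburn decomposition is $\mathbb{Q}G=\mathbb{Q}Ge_1\oplus\dots\oplus\mathbb{Q}Ge_n$; the simple components are the $\mathbb{Q}Ge_i$, each isomorphic to a matrix ring $M_{n_i}(D_i)$ over a division algebra $D_i$. $\mathcal{U}(R)$ denotes the unit group of a ring $R$. $\mathbb{N}$ includes $0$. *)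

(* Defs.v *)
From HB Require Import structures.
From mathcomp Require Import all_boot all_order all_algebra.
From mathcomp Require Import all_fingroup all_solvable all_field all_character.
From mathcomp Require Import finmap.

Set Implicit Arguments.
Unset Strict Implicit.
Unset Printing Implicit Defensive.

Import Order.TTheory GRing.Theory Num.Theory.

Local Open Scope ring_scope.

Section WedderburnComponents.

(* The group algebra QG is [group_ring rat G]: QG acting faithfully on its    *)
(* regular module, an algebra of #|G| x #|G| matrices with unit 1%:M; the     *)
(* membership (a \in group_ring rat G)%MS reads "a belongs to QG".            *)
Variables (gT : finGroupType) (G : {group gT}).
Implicit Types a e u : 'M[rat]_#|G|.

Definition central_idempotent e : Prop :=
  (e \in 'Z(group_ring rat G))%MS /\ e *m e = e.

Definition primitive_central_idempotent e : Prop :=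
  [/\ central_idempotent e, e != 0
    & forall e1 e2, central_idempotent e1 -> central_idempotent e2 ->
        e1 *m e2 = 0 -> e = e1 + e2 -> e1 = 0 \/ e2 = 0].

Definition in_component e u : Prop :=
  exists2 a, (a \in group_ring rat G)%MS & u = a *m e.

(* As a ring, the component QG e has unit e, hence the clause f 1 = e.        *)
Definition component_isomorphic e (R : nzRingType) : Prop :=
  exists f : {additive R -> 'M[rat]_#|G|},
    [/\ injective f, f 1 = e, forall x y, f (x * y) = f x *m f y
      & forall u, in_component e u <-> exists x, u = f x].

End WedderburnComponents.

Arguments central_idempotent {gT} G e.
Arguments primitive_central_idempotent {gT} G e.
Arguments in_component {gT} G e u.
Arguments component_isomorphic {gT} G e R.

(* K is (a copy of) the field Q(sqrt m).                                      *)
Definition is_Qsqrt (K : fieldExtType rat) (m : int) : Prop :=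
  exists2 s : K, s ^+ 2 = m%:~R & <<1; s>>%VS = fullv.

Definition imaginary_quadratic (K : fieldExtType rat) : Prop :=
  \dim {:K} = 2%N /\ exists2 m : int, m < 0 & is_Qsqrt K m.

(* MathComp's {unit R} is restricted to finite rings, so a finite subgroup of *)
(* the unit group of R is given by its underlying finite subset of R.         *)
Record finUnitSubgroup (R : unitRingType) := FinUnitSubgroup {
  fus_set : {fset R};
  fus_unit : {subset fus_set <= GRing.unit};
  fus_div : divr_closed (mem fus_set)
}.

Definition fus_type (R : unitRingType) (H : finUnitSubgroup R) : Type :=
  fset_sub_type (fus_set H).
Coercion fus_type : finUnitSubgroup >-> Sortclass.

Section FinUnitSubgroupGroup.

Variables (R : unitRingType) (H : finUnitSubgroup R).

HB.instance Definition _ := Finite.on (fus_type H).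
HB.instance Definition _ := SubType.on (fus_type H).

Fact fus_mem1 : 1 \in fus_set H.
Proof. by case: (fus_div H). Qed.

Fact fus_memV (x : fus_type H) : (val x)^-1 \in fus_set H.
Proof. by rewrite -div1r; case: (fus_div H) => H1; apply=> //; apply: valP. Qed.

Fact fus_memM (x y : fus_type H) : val x * val y \in fus_set H.
Proof.
rewrite -[val y]invrK; case: (fus_div H) => _; apply; first exact: valP.
exact: fus_memV.
Qed.

Definition fus_one : fus_type H := FSetSub fus_mem1.
Definition fus_inv (x : fus_type H) : fus_type H := FSetSub (fus_memV x).
Definition fus_mul (x y : fus_type H) : fus_type H := FSetSub (fus_memM x y).

Fact fus_mulA : associative fus_mul.
Proof. by move=> x y z; apply/val_inj; rewrite /= mulrA. Qed.

Fact fus_mul1 : left_id fus_one fus_mul.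
Proof. by move=> x; apply/val_inj; rewrite /= mul1r. Qed.

Fact fus_mulV : left_inverse fus_one fus_inv fus_mul.
Proof.
by move=> x; apply/val_inj; rewrite /= mulVr //; apply: (fus_unit (valP x)).
Qed.

HB.instance Definition _ :=
  Finite_isGroup.Build (fus_type H) fus_mulA fus_mul1 fus_mulV.

End FinUnitSubgroupGroup.

(* Main.v *)
Require Import Defs.
From HB Require Import structures.
From mathcomp Require Import all_boot all_order all_algebra.
From mathcomp Require Import all_fingroup all_solvable all_field all_character.
From mathcomp Require Import ring zify.

Set Implicit Arguments.
Unset Strict Implicit.
Unset Printing Implicit Defensive.

Import Order.TTheory GRing.Theory Num.Theory.

Local Open Scope ring_scope.

(* Embed K = Q(sqrt m), m < 0, into the complex numbers; an element of K whose
   image is real is rational.  A torsion element A of GL_2(K) with det A = 1 has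
   eigenvalues u and u^-1 = conj u, so tr A is a rational algebraic integer in
   [-2, 2], and A^12 = 1 by Cayley-Hamilton.  The same bound on x + x^-1 shows
   that torsion elements x of K satisfy x^12 = 1.  Hence A^144 = 1 for every
   torsion A, so finite subgroups of GL_2(K) are {2,3}-groups and Burnside's
   p^a q^b theorem applies.

   If M_2(F) is a component of QG, the images of G span M_2(F) over Q, so one of
   them, A, has an irrational trace.  Its determinant d is a root of unity with
   d <> 1.  If d <> -1, then d generates Q(sqrt -1) or Q(sqrt -3).  If d = -1,
   then A^2 has determinant 1, so (tr A)^2 + 2 is an integer in [-2, 2] and
   (tr A)^2 is -4, -3, -2 or -1. *)

(** * Two-by-two matrices and torsion solutions of quadratic equations *)

Lemma mxtrace2 (R : pzRingType) (A : 'M[R]_2) : \tr A = A 0 0 + A 1 1.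
Proof.
by rewrite /mxtrace !big_ord_recl big_ord0 addr0; congr (_ + A _ _); apply: val_inj.
Qed.

Lemma det2 (R : comPzRingType) (A : 'M[R]_2) :
  \det A = A 0 0 * A 1 1 - A 0 1 * A 1 0.
Proof.
rewrite (expand_det_row _ 0) !big_ord_recl big_ord0 /cofactor !det_mx11 !mxE /=.
rewrite expr0 expr1 mul1r addr0 mulN1r mulrN.
by congr (A _ _ * A _ _ - A _ _ * A _ _); apply: val_inj.
Qed.

(** Cayley-Hamilton in size two, checked entry by entry. *)
Lemma sqr_mx2 (R : comNzRingType) (A : 'M[R]_2) :
  A ^+ 2 = \tr A *: A - (\det A)%:M.
Proof.
have ord2 (i : 'I_2) : i = 0 \/ i = 1.
  by case: i => [[|[|i]]] // ?; [left | right]; apply: val_inj.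
rewrite mxtrace2 det2; apply/matrixP=> i j.
rewrite expr2 -mulmxE !mxE !big_ord_recl big_ord0 addr0.
have ->: lift ord0 ord0 = 1 :> 'I_2 by apply: val_inj.
have ->: ord0 = 0 :> 'I_2 by apply: val_inj.
by case: (ord2 i) => ->; case: (ord2 j) => -> /=; ring.
Qed.

Lemma mxtrace_sqr2 (R : comNzRingType) (A : 'M[R]_2) :
  \tr (A ^+ 2) = \tr A ^+ 2 - 2 * \det A.
Proof. by rewrite sqr_mx2 raddfB /= mxtraceZ mxtrace_scalar; ring. Qed.

Lemma int_norm_le2 (z : int) : `|z| <= 2 ->
  [\/ z = 2, z = -2 | [\/ z = -1, z = 0 | z = 1]].
Proof.
move=> z_le.
have: z = 2 \/ z = -2 \/ z = -1 \/ z = 0 \/ z = 1 by lia.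
by case=> [|[|[|[]]]] ->; by [apply: Or31 | apply: Or32
  | apply: Or33; by [apply: Or31 | apply: Or32 | apply: Or33]].
Qed.

(* X^2 - zX + 1 divides X^12 - 1 unless z = 2 or z = -2.  If z = 2, then
   x = 1 + y with y^2 = 0, and x^n = 1 + ny forces y = 0; if z = -2, take -x. *)
Lemma torsion_quadratic (R : nzRingType) (x : R) (z : int) n :
    (forall (y : R) k, (0 < k)%N -> y *+ k = 0 -> y = 0) ->
    `|z| <= 2 -> (0 < n)%N -> x ^+ 2 = x *~ z - 1 -> x ^+ n = 1 ->
  x ^+ 12 = 1.
Proof.
move=> tf z_le n_gt0.
have unip (y : R) k : (0 < k)%N -> y ^+ 2 = y *+ 2 - 1 -> y ^+ k = 1 -> y = 1.
  move=> k_gt0 y2.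
  have powE l : y ^+ l = 1 + (y - 1) *+ l.
    elim: l => [|l IH]; first by rewrite expr0 mulr0n addr0.
    rewrite exprSr IH mulrDl mul1r mulrnAl mulrBl mul1r -expr2 y2.
    have ->: y *+ 2 - 1 - y = y - 1 by rewrite mulr2n addrAC addrK.
    by rewrite mulrS addrA [1 + _]addrC subrK.
  rewrite powE => /eqP; rewrite -subr_eq0 addrC addKr => /eqP /(tf _ _ k_gt0) /eqP.
  by rewrite subr_eq0 => /eqP.
case: (int_norm_le2 z_le) => [-> | -> | [] ->] x2 xn.
- by rewrite (unip x n) // expr1n.
- have /eqP : - x = 1.
    apply: (unip _ (2 * n)%N); first by rewrite muln_gt0.
      by rewrite sqrrN x2 mulNrn.
    by rewrite exprM sqrrN exprAC xn expr1n.
  by rewrite eqr_oppLR => /eqP ->; rewrite -signr_odd.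
- have x3 : x ^+ 3 = 1.
    by rewrite exprS x2 mulrBr mulr1 mulrN1z mulrN -expr2 x2 mulrN1z opprB opprK addrK.
  by rewrite -[12%N]/(3 * 4)%N exprM x3 expr1n.
- move: x2; rewrite mulr0z sub0r => x2.
  by rewrite -[12%N]/(2 * 6)%N exprM x2 -signr_odd.
- have x3 : x ^+ 3 = - 1.
    by rewrite exprS x2 mulrBr mulr1 mulr1z -expr2 x2 mulr1z addrAC subrr sub0r.
  by rewrite -[12%N]/(3 * 4)%N exprM x3 -signr_odd.
Qed.

(** * Quadratic extensions of the rationals and their complex embedding *)

Lemma Qsqrt_coord (K : fieldExtType rat) (s : K) (m : int) :
    s ^+ 2 = m%:~R -> <<1; s>>%VS = fullv ->
  forall x : K, exists ab : rat * rat, x = ab.1%:A + ab.2 *: s.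
Proof.
move=> s2 sK x; have : x \in <<1; s>>%VS by rewrite sK memvf.
case/Fadjoin1_polyP => p ->; elim/poly_ind: p => [|p c [[a b] /= IH]].
  by exists (0, 0); rewrite rmorph0 horner0 !scale0r addr0.
(* One Horner step: [(a + b s) s + c = (c + m b) + a s], since [s^2 = m]. *)
exists (c + m%:~R * b, a) => /=.
rewrite rmorphD rmorphM /= map_polyX map_polyC /= hornerMXaddC IH.
rewrite mulrDl -!scalerAl mul1r -expr2 s2.
rewrite -(rmorph_int (in_alg K)) /= scalerA scalerDl (mulrC b).
by rewrite addrC (addrC (a *: s)) addrA.
Qed.

Lemma negative_nonsquare (K : fieldExtType rat) (s : K) (m : int) :
  m < 0 -> s ^+ 2 = m%:~R -> forall q : rat, s <> q%:A.
Proof.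
move=> m_lt0 s2 q sq; move: s2; rewrite sq -in_algE -rmorphXn -(rmorph_int (in_alg K)).
move/(fmorph_inj (in_alg K)) => q2; have := sqr_ge0 q; rewrite q2 ler0z; lia.
Qed.

(** The map sends [a + b s] to [a + b t] with [t] a complex square root of [m]. A real image with
    [b] nonzero would make [t] real, although [t^2 = m] is negative. *)
Lemma imaginary_embedding (K : fieldExtType rat) (m : int) :
    m < 0 -> is_Qsqrt K m ->
  exists phi : {rmorphism K -> algC},
    forall x, phi x \in Num.real -> exists q : rat, x = q%:A.
Proof.
move=> m_lt0 [s s2 sK]; have coord := Qsqrt_coord s2 sK.
have s_irr := negative_nonsquare m_lt0 s2.
have [ab abE] : {ab : K -> rat * rat | forall x, x = (ab x).1%:A + (ab x).2 *: s}.
  have coordb x : exists ab : rat * rat, x == ab.1%:A + ab.2 *: s.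
    by have [c xc] := coord x; exists c; apply/eqP.
  exists (fun x => xchoose (coordb x)) => x.
  exact/eqP/(xchooseP (coordb x)).
(* Coordinates are unique because [s] is irrational; additivity and multiplicativity of [f] then
   reduce to exhibiting coordinates of [x - y] and [x * y]. *)
have ab_uniq x a b : x = a%:A + b *: s -> ab x = (a, b).
  rewrite {1}[x]abE; case: (ab x) => a' b' /= /eqP; rewrite -subr_eq0 => /eqP e0.
  have sE : (b - b') *: s = (a' - a)%:A.
    by rewrite !scalerBl; apply/eqP; rewrite -subr_eq0 -oppr_eq0 -e0; apply/eqP; ring.
  have [bb | b_neq] := eqVneq b b'.
    move: sE; rewrite bb subrr scale0r => /esym/eqP.
    by rewrite scaler_eq0 oner_eq0 orbF subr_eq0 => /eqP ->.
  case: (s_irr ((b - b')^-1 * (a' - a))).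
  by rewrite -scalerA -sE scalerA mulVf ?scale1r // subr_eq0.
pose t := sqrtC (m%:~R : algC).
pose f x : algC := ratr (ab x).1 + ratr (ab x).2 * t.
have t2 : t ^+ 2 = m%:~R by rewrite sqrtCK.
have fE x a b : x = a%:A + b *: s -> f x = ratr a + ratr b * t.
  by move=> /ab_uniq xE; rewrite /f xE.
have fB : zmod_morphism f.
  move=> x y; rewrite (fE (x - y) ((ab x).1 - (ab y).1) ((ab x).2 - (ab y).2)).
    by rewrite /f !rmorphB /=; ring.
  rewrite {1}[x]abE {1}[y]abE !scalerBl; ring.
have fM : monoid_morphism f.
  split=> [|x y].
    by rewrite (fE 1 1 0) ?rmorph1 ?rmorph0 ?mul0r ?addr0 // scale1r scale0r addr0.
  pose a := (ab x).1; pose b := (ab x).2; pose c := (ab y).1; pose d := (ab y).2.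
  rewrite (fE (x * y) (a * c + b * d * m%:~R) (a * d + b * c)).
    rewrite /f !rmorphD !rmorphM /= rmorph_int -t2 -/a -/b -/c -/d; ring.
  rewrite {1}[x]abE {1}[y]abE -/a -/b -/c -/d.
  have mE : (m%:~R : rat)%:A = s ^+ 2 :> K by rewrite s2 -in_algE rmorph_int.
  rewrite -!(mulr_algl _ s) -!in_algE !rmorphD !rmorphM /= mE; ring.
pose fadd := GRing.isZmodMorphism.Build _ _ f fB.
pose fmul := GRing.isMonoidMorphism.Build _ _ f fM.
pose phi : {rmorphism K -> algC} := HB.pack f fadd fmul.
exists phi => x; rewrite /= /f => xR; exists (ab x).1; rewrite {1}[x]abE.
have [-> | b_neq0] := eqVneq (ab x).2 0; first by rewrite scale0r addr0.
have: t \in Num.real.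
  have := rpredB xR (Creal_Crat (Crat_rat (ab x).1)); rewrite addrC addKr.
  by rewrite fpredMl ?fmorph_eq0 // Creal_Crat ?Crat_rat.
by rewrite realEsqr t2 ler0z leNgt m_lt0.
Qed.

Lemma natr_eq0_rat_ext (K : fieldExtType rat) k : (k%:R == 0 :> K) = (k == 0%N).
Proof. by rewrite -(rmorph_nat (in_alg K)) fmorph_eq0 pnatr_eq0. Qed.

Lemma lmod_torsion_free (K : fieldExtType rat) (V : lmodType K) (v : V) k :
  (0 < k)%N -> v *+ k = 0 -> v = 0.
Proof.
move=> k_gt0 /eqP; rewrite -scaler_nat scaler_eq0 natr_eq0_rat_ext (gtn_eqF k_gt0).
by move/eqP.
Qed.

(** A square root of a negative integer is irrational, so it has degree at least 2 and the field it
    generates already fills [F]. *)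
Lemma generates_quadratic (F : fieldExtType rat) (s : F) (m : int) :
  \dim {:F} = 2%N -> m < 0 -> s ^+ 2 = m%:~R -> is_Qsqrt F m.
Proof.
move=> dimF m_lt0 s2; exists s => //.
apply/eqP; rewrite eqEdim subvf dimF dim_Fadjoin dimv1 muln1 /=.
have : adjoin_degree 1 s != 1%N.
  rewrite adjoin_deg_eq1; apply/negP => /vlineP [q].
  exact: negative_nonsquare m_lt0 s2 q.
have : (0 < adjoin_degree 1 s)%N by [].
lia.
Qed.

Lemma det_exp (R : comNzRingType) k (A : 'M[R]_k.+1) n :
  \det (A ^+ n) = \det A ^+ n.
Proof.
by elim: n => [|n IH]; rewrite ?det1 // !exprS -mulmxE det_mulmx IH.
Qed.

Lemma det_torsion (R : comNzRingType) k (A : 'M[R]_k.+1) n :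
  A ^+ n = 1 -> \det A ^+ n = 1.
Proof. by rewrite -det_exp => ->; rewrite det1. Qed.

(** * Torsion in an imaginary quadratic field and in its 2 x 2 matrices *)

Section ImaginaryQuadraticField.

Variables (K : fieldExtType rat) (phi : {rmorphism K -> algC}).
Hypothesis phi_real : forall x, phi x \in Num.real -> exists q : rat, x = q%:A.

(* The value u + u^-1 = u + conj u is a real algebraic integer of modulus <= 2. *)
Lemma unity_root_sum_int (t : K) (u : algC) n :
    (0 < n)%N -> u ^+ n = 1 -> phi t = u + u^-1 ->
  exists2 z : int, t = z%:~R & `|z| <= 2.
Proof.
move=> n_gt0 un tE.
have u_norm : `|u| = 1.
  by apply/eqP; rewrite -(@pexpr_eq1 _ _ n) // -normrX un normr1.
have uV : u^-1 = u^* by rewrite invC_norm u_norm expr1n invr1 mul1r.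
have t_real : phi t \in Num.real.
  by rewrite CrealE tE uV rmorphD /= conjCK addrC.
have [q tq] := phi_real t_real.
have phi_t : phi t = ratr q by rewrite tq; apply: (fmorph_eq_rat (phi \o in_alg K)).
have t_Aint : phi t \in Aint.
  rewrite tE rpredD //; apply: (Aint_unity_root n_gt0); apply/unity_rootP => //.
  by rewrite exprVn un invr1.
(* A rational algebraic integer is an integer. *)
have /intrP [z zE] : phi t \is a Num.int.
  by apply: Cint_rat_Aint => //; rewrite phi_t Crat_rat.
exists z; first by apply: (fmorph_inj phi); rewrite rmorph_int.
rewrite -(ler_int algC) intr_norm -zE tE (le_trans (ler_normD _ _)) //.
by rewrite normfV u_norm invr1.
Qed.

Lemma unity_root_quadratic (x : K) n :
    (0 < n)%N -> x ^+ n = 1 ->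
  exists2 z : int, x ^+ 2 = x *~ z - 1 & `|z| <= 2.
Proof.
move=> n_gt0 xn.
have x_neq0 : x != 0.
  by apply/eqP => x0; move/eqP: xn; rewrite x0 expr0n (gtn_eqF n_gt0) eq_sym oner_eq0.
have [z zE z_le] : exists2 z : int, x + x^-1 = z%:~R & `|z| <= 2.
  apply: (@unity_root_sum_int _ (phi x) n) => //; first by rewrite -rmorphXn xn rmorph1.
  by rewrite rmorphD fmorphV.
by exists z; rewrite // -mulrzr -zE mulrDr divff // addrK.
Qed.

(** A root [u] of [X^2 - tX + 1] is an eigenvalue of the complex image [B] of [A]. Applying
    [B ^+ n = 1] to an eigenvector gives [u ^+ n = 1], and the trace is [u + u^-1]. *)
Lemma torsion_det1_trace (A : 'M[K]_2) n :
    (0 < n)%N -> A ^+ n = 1 -> \det A = 1 ->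
  exists2 z : int, \tr A = z%:~R & `|z| <= 2.
Proof.
move=> n_gt0 An detA; pose t := phi (\tr A).
(* The coefficient list encodes [u^2 = -1 + t u]. *)
have [u uE] := @solve_monicpoly algC 2 (nth 0 [:: -1; t]) isT.
rewrite !big_ord_recl big_ord0 /= expr0 expr1 mulr1 addr0 in uE.
have u_neq0 : u != 0.
  apply/eqP => u0; move/eqP: uE; rewrite u0 mulr0 addr0 expr0n /=.
  by rewrite eq_sym oppr_eq0 oner_eq0.
pose B := map_mx phi A.
have detB : \det B = 1 by rewrite det_map_mx detA rmorph1.
have : \det (B - u%:M) = 0.
  rewrite det2 !mxE /= !mulr1n !mulr0n !subr0.
  have := uE; rewrite /t mxtrace2; have := detB; rewrite det2 !mxE rmorphD /= => d1 e.
  transitivity (phi (A 0 0) * phi (A 1 1) - phi (A 0 1) * phi (A 1 0) - 1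
      + (u ^+ 2 - (-1 + (phi (A 0 0) + phi (A 1 1)) * u))); first by ring.
  by rewrite d1 -e !subrr addr0.
move/eqP/det0P => [v v_neq0]; rewrite mulmxBr mul_mx_scalar => /eqP.
rewrite subr_eq0 => /eqP vB.
have vBk k : v *m (B ^+ k) = u ^+ k *: v.
  elim: k => [|k IH]; first by rewrite mulmx1 scale1r.
  by rewrite exprSr -mulmxE mulmxA IH -scalemxAl vB scalerA -exprSr.
apply: (unity_root_sum_int n_gt0 (u := u)).
  have := vBk n; rewrite /B -(rmorphXn (map_mx phi)) An rmorph1 mulmx1 => /eqP.
  rewrite -subr_eq0 -{1}[v]scale1r -scalerBl scaler_eq0 (negPf v_neq0) orbF.
  by rewrite subr_eq0 => /eqP.
apply: (mulfI u_neq0); rewrite -/t mulrDr divff // -expr2 uE; ring.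
Qed.

Lemma torsion_det1_exp12 (A : 'M[K]_2) n :
  (0 < n)%N -> A ^+ n = 1 -> \det A = 1 -> A ^+ 12 = 1.
Proof.
move=> n_gt0 An detA; have [z trA z_le] := torsion_det1_trace n_gt0 An detA.
apply: (torsion_quadratic (z := z) (n := n)) => //; last first.
  by rewrite sqr_mx2 trA detA scaler_int.
exact: lmod_torsion_free.
Qed.

(** The determinant is a torsion element of [K], so its 12th power is 1. Thus [A ^+ 12] has
    determinant 1 and is itself killed by the exponent 12. *)
Lemma torsion_exp144 (A : 'M[K]_2) n :
  (0 < n)%N -> A ^+ n = 1 -> A ^+ 144 = 1.
Proof.
move=> n_gt0 An.
have dn := det_torsion An.
rewrite (exprM A 12 12); apply: (torsion_det1_exp12 n_gt0).
  by rewrite exprAC An expr1n.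
have [z dz z_le] := unity_root_quadratic n_gt0 dn.
rewrite det_exp; apply: (torsion_quadratic _ z_le n_gt0 dz dn) => y k.
exact: (@lmod_torsion_free K K^o).
Qed.

Lemma torsion_trace_Qsqrt (A : 'M[K]_2) n :
    \dim {:K} = 2%N -> (0 < n)%N -> A ^+ n = 1 -> \tr A \notin 1%VS ->
  [\/ is_Qsqrt K (-1), is_Qsqrt K (-2) | is_Qsqrt K (-3)].
Proof.
move=> dimK n_gt0 An trA; have sqrt_gen m s := @generates_quadratic K s m dimK.
have int_rat (z : int) : z%:~R \in (1%VS : {vspace K}) by rewrite rpred_int.
have [z dz z_le] := unity_root_quadratic n_gt0 (det_torsion An).
case: (int_norm_le2 z_le) dz => [-> | -> | [] ->] dz.
(* Here [z = 2] forces determinant 1, so the trace would be an integer. *)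
- have /eqP : (\det A - 1) ^+ 2 = 0 by rewrite sqrrB1 dz; ring.
  rewrite expf_eq0 subr_eq0 /= => /eqP d1.
  by have [y yE _] := torsion_det1_trace n_gt0 An d1; rewrite yE int_rat in trA.
- have /eqP : (\det A + 1) ^+ 2 = 0 by rewrite sqrrD1 dz; ring.
  rewrite expf_eq0 addr_eq0 /= => /eqP dN1.
  have A2n : (A ^+ 2) ^+ n = 1 by rewrite exprAC An expr1n.
  have A2d : \det (A ^+ 2) = 1 by rewrite det_exp dN1 sqrrN expr1n.
  have [y yE y_le] := torsion_det1_trace n_gt0 A2n A2d.
  have t2 : \tr A ^+ 2 = y%:~R - 2 by rewrite -yE mxtrace_sqr2 dN1; ring.
  case: (int_norm_le2 y_le) t2 => [-> | -> | [] ->] t2.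
  + move/eqP: t2; rewrite subrr expf_eq0 /= => /eqP t0.
    by rewrite t0 mem0v in trA.
  (* Here [y = -2], the squared trace is -4, and half the trace squares to -1. *)
  + apply: Or31; apply: (sqrt_gen _ (\tr A / 2)) => //.
    by rewrite expr_div_n t2; field; rewrite natr_eq0_rat_ext.
  + by apply: Or33; apply: (sqrt_gen _ (\tr A)) => //; rewrite t2; ring.
  + by apply: Or32; apply: (sqrt_gen _ (\tr A)) => //; rewrite t2; ring.
  + by apply: Or31; apply: (sqrt_gen _ (\tr A)) => //; rewrite t2; ring.
(* For [z = -1] the determinant [d] satisfies [d^2 + d + 1 = 0]; completing the square gives
   [(2d + 1)^2 = -3]. The case [z = 1] is the same with [2d - 1]. *)
- apply: Or33; apply: (sqrt_gen _ (2 * \det A + 1)) => //.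
  by rewrite sqrrD1 exprMn dz; ring.
- by apply: Or31; apply: (sqrt_gen _ (\det A)) => //; rewrite dz; ring.
- apply: Or33; apply: (sqrt_gen _ (2 * \det A - 1)) => //.
  by rewrite sqrrB1 exprMn dz; ring.
Qed.

End ImaginaryQuadraticField.

(** * Traces of the group elements inside a matrix component *)

Section ComponentOverField.

Variables (gT : finGroupType) (G : {group gT}) (F : fieldExtType rat) (k : nat).
Variables (e : 'M[rat]_#|G|) (f : {additive 'M[F]_k.+1 -> 'M[rat]_#|G|}).
Hypotheses (cent_e : central_idempotent G e) (f_inj : injective f) (f1 : f 1 = e).
Hypothesis fM : forall x y, f (x * y) = f x *m f y.
Hypothesis f_im : forall u, in_component G e u <-> exists x, u = f x.

Let aG := regular_repr rat G.

(** Only additivity of [f] is given; additive maps between rational vector spaces are linear. *)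
Lemma component_scale (c : rat) (x : 'M[F]_k.+1) : f (c%:A *: x) = c *: f x.
Proof.
pose h (a : rat^o) := f (a%:A *: x).
have h_add : zmod_morphism h by move=> a b; rewrite /h !scalerBl raddfB.
have -> : f x = h 1 by rewrite /h !scale1r.
by rewrite -(rat_linear h_add); congr (f (_%:A *: _)); rewrite [RHS]mulr1.
Qed.

Lemma component_repr_exp g x n :
  g \in G -> f x = aG g *m e -> f (x ^+ n) = aG (g ^+ n)%g *m e.
Proof.
case: cent_e; rewrite sub_capmx => /andP[_ /cent_mxP eC] ee gG fx.
elim: n => [|n IH]; first by rewrite expr0 f1 expg0 repr_mx1 mul1mx.
rewrite exprSr fM IH fx expgSr repr_mxM ?groupX // -!mulmxA; congr (_ *m _).
by rewrite mulmxA -eC ?envelop_mx_id // -mulmxA ee.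
Qed.

(** The preimages [h g] of the projected group elements are torsion and span the matrix ring over
    the rationals. If all their traces were rational, so would be every trace, including that of
    [s *: delta_mx 0 0]. *)
Lemma component_irrational_trace (s : F) : s \notin 1%VS ->
  exists2 x : 'M[F]_k.+1, \tr x \notin 1%VS & exists2 n, (0 < n)%N & x ^+ n = 1.
Proof.
move=> s_irr.
(* The boolean implication makes the choice of a preimage total in [g]. *)
have lift_g g : exists x, (g \in G) ==> (f x == aG g *m e).
  have [gG | _] := boolP (g \in G); last by exists 0.
  have [|x xE] := (f_im (aG g *m e)).1; last by exists x; rewrite xE /=.
  by exists (aG g) => //; apply: envelop_mx_id.
pose h g := xchoose (lift_g g).
have hE g : g \in G -> f (h g) = aG g *m e.
  by move=> gG; apply/eqP; apply: (implyP (xchooseP (lift_g g)) gG).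
have [/exists_inP [g gG trg] | all_rat] :=
    boolP [exists g in G, \tr (h g) \notin 1%VS].
  exists (h g) => //; exists #[g]%g; first exact: order_gt0.
  by apply: f_inj; rewrite (component_repr_exp _ gG (hE g gG)) expg_order repr_mx1
    mul1mx f1.
case/negP: s_irr; pose x : 'M[F]_k.+1 := s *: delta_mx 0 0.
have [a /envelop_mxP [c ->] fx] := (f_im (f x)).2 (ex_intro _ x erefl).
have xE : x = \sum_(g in G) (c g)%:A *: h g.
  apply: f_inj; rewrite fx raddf_sum mulmx_suml; apply: eq_bigr => g gG.
  by rewrite component_scale (hE g gG) scalemxAl.
have -> : s = \tr x.
  rewrite mxtraceZ /mxtrace (bigD1 0) //= mxE eqxx big1 ?addr0 ?mulr1 // => i /negPf i0.
  by rewrite mxE i0.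
rewrite xE raddf_sum rpred_sum // => g gG /=.
rewrite mxtraceZ mulr_algl rpredZ //.
by move: all_rat; rewrite negb_exists_in => /forall_inP /(_ g gG); rewrite negbK.
Qed.

End ComponentOverField.

(** * Finite groups of exponent dividing 144, and the conclusion *)

Lemma finUnitSubgroup_valX (R : unitRingType) (H : finUnitSubgroup R) (x : H) n :
  val (x ^+ n)%g = val x ^+ n.
Proof. by elim: n => // n IH; rewrite expgSr exprSr -IH. Qed.

Lemma solvable_exponent144 (gT : finGroupType) (G : {group gT}) :
    (forall x, x \in G -> (x ^+ 144 = 1)%g) ->
  solvable G /\ exists a b, #|G| = (2 ^ a * 3 ^ b)%N.
Proof.
move=> exp144.
have prime23 p : prime p -> (p %| #|G|)%N -> p \in [:: 2; 3]%N.
  move=> p_pr /(Cauchy p_pr) [x xG xp].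
  (* Cauchy's theorem gives an element of order [p], and [144 = 2^4 * 3^2]. *)
  have : (p %| 2 ^ 4 * 3 ^ 2)%N by rewrite -xp order_dvdn exp144.
  by rewrite Euclid_dvdM // !Euclid_dvdX // !andbT !dvdn_prime2 // !inE.
split.
  apply: Burnside_p_a_q_b; apply: (uniq_leq_size (s2 := [:: 2; 3]%N)) (primes_uniq _) _.
  by move=> p; rewrite mem_primes => /and3P [p_pr _]; apply: prime23.
have /p_natP [b b_eq] : (3.-nat #|G|`_2^')%N.
  apply/pnatP => // p p_pr p_dvd; have := prime23 p p_pr (dvdn_trans p_dvd (dvdn_part _ _)).
  rewrite !inE => /orP[/eqP p2 | //].
  have : p \in (2^')%N.
    by apply: pnatPpi (part_pnat (2^')%N #|G|) _; rewrite mem_primes p_pr part_gt0.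
  by rewrite p2.
have [a a_eq] := p_natP (part_pnat 2%N #|G|).
by exists a, b; rewrite -a_eq -b_eq partnC.
Qed.

Theorem theorem3p1 (gT : finGroupType) (G : {group gT}) :
  (forall (e : 'M[rat]_#|G|) (F : fieldExtType rat),
     primitive_central_idempotent G e ->
     imaginary_quadratic F ->
     component_isomorphic G e 'M[F]_2 ->
     exists K : fieldExtType rat,
       [\/ is_Qsqrt K (-1), is_Qsqrt K (-2) | is_Qsqrt K (-3)]
       /\ component_isomorphic G e 'M[K]_2)
  /\
  (forall (K : fieldExtType rat) (H : finUnitSubgroup 'M[K]_2),
     [\/ is_Qsqrt K (-1), is_Qsqrt K (-2) | is_Qsqrt K (-3)] ->
     solvable [set: H] /\
     exists a b : nat, #|[set: H]| = (2 ^ a * 3 ^ b)%N).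
Proof.
split=> [e F [cent_e _ _] [dimF [m m_lt0 sqrtF]] isoF | K H sqrtK].
  (* The given field [F] is itself shown to be one of the three. *)
  exists F; split=> //; have [f [f_inj f1 fM f_im]] := isoF.
  have [phi phi_real] := imaginary_embedding m_lt0 sqrtF.
  have [s s2 _] := sqrtF.
  have s_irr : s \notin 1%VS.
    by apply/negP => /vlineP [q]; apply: negative_nonsquare m_lt0 s2 q.
  have [x trx [n n_gt0 xn]] := component_irrational_trace cent_e f_inj f1 fM f_im s_irr.
  exact: (torsion_trace_Qsqrt phi_real dimF n_gt0 xn trx).
have [m m_lt0 {}sqrtK] : exists2 m : int, m < 0 & is_Qsqrt K m.
  by case: sqrtK => sqrtK; [exists (-1) | exists (-2) | exists (-3)].
have [phi phi_real] := imaginary_embedding m_lt0 sqrtK.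
apply: (@solvable_exponent144 _ [set: H]%G) => x _; apply: val_inj.
rewrite finUnitSubgroup_valX.
apply: (torsion_exp144 phi_real (order_gt0 x)).
by rewrite -finUnitSubgroup_valX expg_order.
Qed.
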